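(* Let $F=(\nu_j)_{j\in J}$ be a family of set functions $\nu_j:\mathcal{S}\to\overline{\mathbb{R}}$ defined on a semi-ring $\mathcal{S}$ of subsets of a set $\Omega$, such that $\sup_{j\in J}\nu_j(A)>-\infty$ for all $A\in\mathcal{S}$. Define $$\mu_F(A):=\sup_{\Pi\in\mathscr{P}(A)}\ \sum_{C\in\Pi}\ \sup_{j\in J}\nu_j(C),\qquad A\in\mathcal{S}.$$ Then $\mu_F$ is super-additive. Moreover, if $F\subseteq c(\mathcal{S})$, then $\mu_F\in c(\mathcal{S})$ and $\mu_F=\sup F$, i.e. $\mu_F$ is the least upper bound of $F$ in $c(\mathcal{S})$.
   Context: A semi-ring $\mathcal{S}$ of subsets of $\Omega$ is a family with $\emptyset\in\mathcal{S}$, closed under finite intersections, and such that for $A,B\in\mathcal{S}$ the set $A\setminus B$ is a finite disjoint union of elements of $\mathcal{S}$. Here $\overline{\mathbb{R}}=[-\infty,\infty]$, and set functions are assumed to vanish at $\emptyset$. $\mathscr{P}(A)$ denotes the family of all finite partitions of $A$ by (pairwise disjoint) elements of $\mathcal{S}$. A set function $\mu$ on $\mathcal{S}$ with values in $(-\infty,\infty]$ is super-additive if $\mu(\bigcup_i A_i)\ge\sum_i\mu(A_i)$ for every finite family $(A_i)$ of pairwise disjoint elements of $\mathcal{S}$ whose union belongs to $\mathcal{S}$. A signed charge on $\mathcal{S}$ is a set function $\mu:\mathcal{S}\to\overline{\mathbb{R}}$ with $\mu(\emptyset)=0$ that avoids at least one of the values $+\infty,-\infty$ and is finitely additive, i.e.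 $\mu(\bigcup_i A_i)=\sum_i\mu(A_i)$ for every finite family of pairwise disjoint elements of $\mathcal{S}$ with union in $\mathcal{S}$. $c(\mathcal{S})$ is the set of all signed charges on $\mathcal{S}$, ordered by $\mu\le\nu\iff\mu(A)\le\nu(A)$ for all $A\in\mathcal{S}$. *)

(* Defs.v *)
From HB Require Import structures.
From mathcomp Require Import all_boot all_order all_algebra.
From mathcomp Require Import all_classical all_reals.
From mathcomp Require Import ereal measure.

Set Implicit Arguments.
Unset Strict Implicit.
Unset Printing Implicit Defensive.
Import Order.TTheory GRing.Theory Num.Theory.

Local Open Scope classical_set_scope.
Local Open Scope ring_scope.
Local Open Scope ereal_scope.

(* A set function on a family S of subsets of Omega is represented by a total
   function on all subsets; only its values on S are meaningful, and every
   definition below only inspects those values.  The library structure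
   semiRingOfSetsType is not used because it forces Omega to be pointed, hence
   nonempty. *)

Definition is_semi_ring (Omega : Type) (S : set (set Omega)) : Prop :=
  [/\ S set0, setI_closed S & semi_setD_closed S].

(* The library predicate [partition] asks for nonempty blocks; as set functions
   vanish at set0, this does not affect sums over partitions. *)
Definition finite_partitions (Omega : Type) (S : set (set Omega))
    (A : set Omega) : set (set (set Omega)) :=
  [set P | [/\ finite_set P, P `<=` S & partition P id A]].

Definition set_function (R : realType) (Omega : Type)
    (mu : set Omega -> \bar R) : Prop := mu set0 = 0.

Definition super_additive (R : realType) (Omega : Type)
    (S : set (set Omega)) (mu : set Omega -> \bar R) : Prop :=
  [/\ set_function mu,
      forall A, S A -> mu A != -oo &
      forall (n : nat) (A : 'I_n -> set Omega),
        (forall i, S (A i)) -> trivIset setT A -> S (\bigcup_i A i) ->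
        \sum_(i < n) mu (A i) <= mu (\bigcup_i A i)].

(* As one of the values +oo and -oo is avoided, the sums below never meet the
   library convention +oo + -oo = -oo. *)
Definition signed_charges (R : realType) (Omega : Type)
    (S : set (set Omega)) : set (set Omega -> \bar R) :=
  [set mu | [/\ set_function mu,
      (forall A, S A -> mu A != +oo) \/ (forall A, S A -> mu A != -oo) &
      forall (n : nat) (A : 'I_n -> set Omega),
        (forall i, S (A i)) -> trivIset setT A -> S (\bigcup_i A i) ->
        mu (\bigcup_i A i) = \sum_(i < n) mu (A i)]].

Definition le_on (R : realType) (Omega : Type) (S : set (set Omega))
    (mu nu : set Omega -> \bar R) : Prop :=
  forall A, S A -> mu A <= nu A.

Definition is_sup_charges (R : realType) (Omega : Type)
    (S : set (set Omega)) (F : set (set Omega -> \bar R))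
    (mu : set Omega -> \bar R) : Prop :=
  [/\ signed_charges S mu,
      forall nu, F nu -> le_on S nu mu &
      forall lambda, signed_charges S lambda ->
        (forall nu, F nu -> le_on S nu lambda) -> le_on S mu lambda].

Definition pointwise_sup (R : realType) (Omega J : Type)
    (nu : J -> set Omega -> \bar R) (A : set Omega) : \bar R :=
  ereal_sup (range (fun j => nu j A)).

Definition mu_sup (R : realType) (Omega J : Type) (S : set (set Omega))
    (nu : J -> set Omega -> \bar R) (A : set Omega) : \bar R :=
  ereal_sup [set \sum_(C \in P) pointwise_sup nu C
            | P in finite_partitions S A].

(* Main.v *)
Require Import Defs.
From mathcomp Require Import all_boot all_order all_algebra.
From mathcomp Require Import finmap.
From mathcomp Require Import all_classical all_reals.
From mathcomp Require Import ereal measure.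

(** Write [s] for the pointwise supremum of the family, so that [mu_sup S nu] is
    the supremum over finite partitions [P] of the sums of [s] over [P].

    Super-additivity ([partition_sup_super_additive]) comes from merging: if [A] is the disjoint union of
    the [A i], then partitions of the pieces can be merged into one partition of
    [A], so every choice of sums over partitions of the pieces adds up to at
    most [mu_sup S nu A].  Passing from these choices to the sum of the suprema
    is [sum_ereal_sup_le].

    When the [nu j] are charges, [s] is sub-additive
    ([pointwise_sup_sub_additive]), since a supremum of sums is at most the sum
    of the suprema.  Sub-additivity survives the passage to the supremum over
    partitions ([partition_sup_sub_additive]): cutting each block of a partition
    of [A] along the [A i] does not decrease the sum of [s], and the cut blocks
    inside a fixed [A i] partition it.  Hence [mu_sup S nu] is additive.  It
    dominates [s], by the partition with one block, and any charge dominating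
    [s] dominates each sum over a partition, by its own additivity
    ([partition_sup_le_charge]); so it is the least upper bound.

    Blocks of a partition are nonempty and pairwise distinct, whereas merging
    and cutting naturally produce indexed families in which the empty set may
    occur, even repeatedly.  As [s] vanishes there, sums over such families are
    sums over partitions ([fsum_le_partition_sup]). *)

Set Implicit Arguments.
Unset Strict Implicit.
Unset Printing Implicit Defensive.

Import Order.TTheory GRing.Theory Num.Theory.

Local Open Scope classical_set_scope.
Local Open Scope ring_scope.
Local Open Scope ereal_scope.

(** * Sums of suprema of extended reals *)

(** For real [c] one subtracts [c] from [M].  For [c = +oo] a single element of
    [T] other than [-oo] forces [M = +oo]. *)
Lemma ereal_sup_addr_le (R : realType) (T : set (\bar R)) (c M : \bar R) :
  (forall y, T y -> y != -oo) -> (forall y, T y -> y + c <= M) ->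
  ereal_sup T + c <= M.
Proof.
move=> TNy TM.
have [->|/set0P[y0 Ty0]] := eqVneq T set0.
  by rewrite ereal_sup0 addNye leNye.
case: c TM => [c| |] TM.
- by rewrite -leeBrDr//; apply: ge_ereal_sup => y /TM; rewrite leeBrDr.
- by have := TM _ Ty0; rewrite addey ?TNy// leye_eq => /eqP ->; rewrite leey.
- by rewrite addeNy leNye.
Qed.

(** The extra summand [c] makes the induction on [n] work: the suprema are
    replaced one at a time, an element already chosen being absorbed in [c], so
    that nothing ever has to be subtracted from [M]. *)
Lemma sum_ereal_sup_le (R : realType) (n : nat) (T : 'I_n -> set (\bar R))
    (c M : \bar R) :
  (forall i y, T i y -> y != -oo) ->
  (forall x : 'I_n -> \bar R, (forall i, T i (x i)) ->
    c + \sum_(i < n) x i <= M) ->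
  c + \sum_(i < n) ereal_sup (T i) <= M.
Proof.
elim: n T c => [|n IH] T c TNy TM.
  by have := TM (fun=> 0); rewrite !big_ord0; apply; case.
rewrite big_ord_recl addeCA; apply: ereal_sup_addr_le => [y|y T0y].
  exact: TNy.
rewrite addeA; apply: IH => [i|x Tx]; first exact: TNy.
have := TM (fun i => oapp x y (unlift ord0 i)).
rewrite big_ord_recl unlift_none/=.
under eq_bigr do rewrite liftK/=.
rewrite addeCA addeA; apply=> i.
by case: unliftP => [j|] ->.
Qed.

(** * Partitions obtained from disjoint families *)

Lemma finite_partitions_of_family (Omega : Type) (I : choiceType)
    (S : set (set Omega)) (D : set I) (B : I -> set Omega) :
  finite_set D -> (forall i, D i -> S (B i)) -> trivIset D B ->
  finite_partitions S (\bigcup_(i in D) B i) (B @` D `\ set0).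
Proof.
move=> Dfin SB tB; split.
- exact/finite_setD/finite_image.
- by move=> _ [[i Di <-] _]; exact: SB.
split.
- apply/seteqP; split=> [y [_ [[i Di <-] _] By]|y [i Di By]].
    by exists i.
  exists (B i) => //; by split; [exists i|move=> B0; rewrite B0 in By].
- by move=> _ _ [[i Di <-] _] [[j Dj <-] _] /(tB _ _ Di Dj) ->.
- by move=> C [_ /eqP/set0P].
Qed.

(** Disjointness makes [B] injective away from the indices with [B i] empty, and
    those contribute zero. *)
Lemma fsum_family (R : realType) (Omega : Type) (I : choiceType)
    (D : set I) (B : I -> set Omega) (s : set Omega -> \bar R) :
  set_function s -> trivIset D B ->
  \sum_(i \in D) s (B i) = \sum_(C \in B @` D `\ set0) s C.
Proof.
move=> s0 tB; pose D' := D `&` [set i | B i !=set0].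
have -> : B @` D `\ set0 = B @` D'.
  apply/seteqP; split=> [_ [[i Di <-] /eqP/set0P Bi0]|_ [i [Di Bi0] <-]].
    by exists i.
  by split; [exists i|apply/eqP/set0P].
rewrite fsbig_image; last first.
  move=> i j /[!inE] -[Di [x Bix]] [Dj _] BE; apply: tB => //.
  by exists x; split => //; rewrite -BE.
apply/esym/fsbig_widen => [i []//|i [Di D'i] /=].
have [->|/set0P Bi] := eqVneq (B i) set0; first exact: s0.
by case: D'i.
Qed.

(** * The supremum over partitions *)

(** By definition, [mu_sup S nu] is [partition_sup S (pointwise_sup nu)]; the
    properties of the construction depend on the family only through its
    pointwise supremum. *)
Definition partition_sup (R : realType) (Omega : Type) (S : set (set Omega))
    (s : set Omega -> \bar R) (A : set Omega) : \bar R :=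
  ereal_sup [set \sum_(C \in P) s C | P in finite_partitions S A].

Lemma fsum_le_partition_sup (R : realType) (Omega : Type) (I : choiceType)
    (S : set (set Omega)) (s : set Omega -> \bar R) (D : set I)
    (B : I -> set Omega) (A : set Omega) :
  set_function s -> finite_set D -> (forall i, D i -> S (B i)) ->
  trivIset D B -> \bigcup_(i in D) B i = A ->
  \sum_(i \in D) s (B i) <= partition_sup S s A.
Proof.
move=> s0 Dfin SB tB <-; apply: ereal_sup_ubound.
exists (B @` D `\ set0); first exact: finite_partitions_of_family.
by rewrite -fsum_family.
Qed.

Lemma le_partition_sup (R : realType) (Omega : Type) (S : set (set Omega))
    (s : set Omega -> \bar R) :
  set_function s -> le_on S s (partition_sup S s).
Proof.
move=> s0 A SA.
have -> : s A = \sum_(i \in [set tt]) s A by rewrite fsbig_set1.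
apply: (@fsum_le_partition_sup _ _ _ _ _ _ (fun=> A)) => //.
- by move=> [] [].
- by rewrite bigcup_set1.
Qed.

Lemma partition_sup0 (R : realType) (Omega : Type) (S : set (set Omega))
    (s : set Omega -> \bar R) : S set0 ->
  set_function s -> set_function (partition_sup S s).
Proof.
move=> S0 s0; apply/eqP; rewrite eq_le; apply/andP; split; last first.
  by rewrite -[leLHS]s0; exact: le_partition_sup.
apply: ge_ereal_sup => _ [P [_ _ [cP _ P0]] <-].
rewrite fsbig1// => C PC; have [x Cx] := P0 _ PC.
by have : cover P id x by [exists C]; rewrite cP.
Qed.

Lemma fsum_neqNy (R : realType) (I : choiceType) (D : set I)
    (f : I -> \bar R) : finite_set D ->
  (forall i, D i -> f i != -oo) -> \sum_(i \in D) f i != -oo.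
Proof.
move=> Dfin fNy; rewrite fsbig_finite// big_seq.
apply: (big_ind (fun x => x != -oo)) => // [x y xNy yNy|i].
  by rewrite adde_eq_ninfty negb_or xNy.
by rewrite in_fset_set// inE => /fNy.
Qed.

Lemma sum_ord_fsum (R : realType) (n : nat) (f : 'I_n -> \bar R) :
  \sum_(i < n) f i = \sum_(i \in setT) f i.
Proof.
rewrite bigfs ?index_enum_uniq//; last first.
  by move=> i _; rewrite mem_index_enum.
by apply: eq_fsbigl; apply/seteqP; split.
Qed.

(** Merging partitions of the pieces gives a partition of the union. That [s]
    avoids [-oo] ensures that so do all sums over partitions, as is needed to
    pass from these sums to their suprema. *)
Lemma partition_sup_super_additive (R : realType) (Omega : Type)
    (S : set (set Omega)) (s : set Omega -> \bar R) :
  S set0 -> set_function s -> (forall A, S A -> -oo < s A) ->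
  super_additive S (partition_sup S s).
Proof.
move=> S0 s0 sNy; split.
- exact: partition_sup0.
- move=> A SA; rewrite -ltNye; apply: lt_le_trans (sNy _ SA) _.
  exact: le_partition_sup.
move=> n A SA tA SUA; rewrite -[leLHS]add0e; apply: sum_ereal_sup_le.
  move=> i _ [P [Pfin PS _] <-]; apply: fsum_neqNy => // C /PS /sNy.
  by rewrite ltNye.
move=> x /(_ _)/cid2-/all_sig2[P PA xE]; rewrite add0e.
under eq_bigr do rewrite -xE.
(* The double sum runs over pairs (i, C) with C in P i, a dependent index set.
   It is turned into a product by letting C range over all blocks Q and
   replacing C by the empty set when it does not belong to P i. *)
pose Q := \bigcup_i P i.
have Pfin i : finite_set (P i) by case: (PA i).
have PS i : P i `<=` S by case: (PA i).
have PcA i C : P i C -> C `<=` A i.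
  by case: (PA i) => _ _ [<- _ _] PC y Cy; exists C.
have Qfin : finite_set Q by exact: bigcup_finite.
pose B (p : 'I_n * set Omega) := if p.2 \in P p.1 then p.2 else set0.
have BE i : \sum_(C \in P i) s C = \sum_(C \in Q) s (B (i, C)).
  rewrite -[P i](_ : P i `&` Q = _); last first.
    by apply/setIidPl => C PC; exists i.
  rewrite fsbig_mkcondl; apply: eq_fsbigr => C _; rewrite /B/=.
  by case: ifPn => // _; rewrite s0.
under eq_bigr do rewrite BE.
rewrite sum_ord_fsum (pair_fsbig _ (fun i C => s (B (i, C))))//=.
under eq_fsbigr do rewrite -surjective_pairing.
apply: fsum_le_partition_sup => //.
- by apply: finite_setX => //; exact: finite_finset.
- by move=> [i C] _; rewrite /B/=; case: ifPn => // /[!inE] /PS.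
- move=> [i C] [j C'] _ _; rewrite /B/=.
  case: ifPn => [/[!inE] PC|_]; last by rewrite set0I => -[].
  case: ifPn => [/[!inE] PC'|_]; last by rewrite setI0 => -[].
  case=> y [Cy C'y].
  have ij : i = j.
    by apply: tA => //; exists y; split; [exact: PcA Cy|exact: PcA C'y].
  subst j; case: (PA i) => _ _ [_ tP _]; congr (_, _).
  by apply: tP => //; exists y.
- apply/seteqP; split=> [y [[i C] _]|y [i _]].
    rewrite /B/=; case: ifPn => // /[!inE] PC Cy.
    by exists i => //; exact: PcA Cy.
  case: (PA i) => _ _ [<- _ _] [C PC Cy]; exists (i, C).
    by split => //; exists i.
  by rewrite /B/= ifT// inE.
Qed.

Definition sub_additive (R : realType) (Omega : Type)
    (S : set (set Omega)) (mu : set Omega -> \bar R) : Prop :=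
  forall (n : nat) (A : 'I_n -> set Omega),
    (forall i, S (A i)) -> trivIset setT A -> S (\bigcup_i A i) ->
    mu (\bigcup_i A i) <= \sum_(i < n) mu (A i).

(** Each block is the disjoint union of its traces on the [A i], which belong to
    [S]; exchanging the two sums groups these traces by [i]. *)
Lemma partition_sup_sub_additive (R : realType) (Omega : Type)
    (S : set (set Omega)) (s : set Omega -> \bar R) :
  setI_closed S -> set_function s -> sub_additive S s ->
  sub_additive S (partition_sup S s).
Proof.
move=> SI s0 ss n A SA tA SUA.
apply: ge_ereal_sup => _ [P [Pfin PS [cP tP P0]] <-].
have Ccut C : P C -> \bigcup_i (A i `&` C) = C.
  move=> PC; rewrite -setI_bigcupl; apply/setIidPr.
  by rewrite -cP => y Cy; exists C.
apply: (@le_trans _ _ (\sum_(C \in P) \sum_(i < n) s (A i `&` C))).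
  apply: lee_fsum => // C PC; rewrite -[in leLHS](Ccut _ PC); apply: ss.
  - by move=> i; apply: SI => //; exact: PS.
  - exact: trivIset_setIr.
  - by rewrite Ccut//; exact: PS.
rewrite fsbig_finite// exchange_big/=; apply: lee_sum => i _.
rewrite -fsbig_finite//; apply: fsum_le_partition_sup => //.
- by move=> C PC; apply: SI => //; exact: PS.
- exact: trivIset_setIl.
- rewrite -setI_bigcupr; apply/setIidPl.
  by move: cP; rewrite coverE => -> y Ay; exists i.
Qed.

(** * Charges *)

(** Additivity of a charge concerns families indexed by ['I_n]; enumerating the
    blocks turns it into a statement about partitions. *)
Lemma signed_charge_fsum (R : realType) (Omega : Type) (S : set (set Omega))
    (mu : set Omega -> \bar R) (A : set Omega) (P : set (set Omega)) :
  signed_charges S mu -> S A -> finite_partitions S A P ->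
  mu A = \sum_(C \in P) mu C.
Proof.
move=> [_ _ mu_add] SA [Pfin PS [cP tP _]].
rewrite fsbig_finite//.
set r : seq (set Omega) := fset_set P.
have rP C : (C \in r) = (C \in P) by rewrite in_fset_set.
have ur : uniq r by exact: fset_uniq.
pose B (i : 'I_(size r)) := nth set0 r i.
have PB i : P (B i) by rewrite -in_setE -rP mem_nth.
have UB : \bigcup_i B i = A.
  rewrite -cP; apply/seteqP; split=> [y [i _ Biy]|y [C PC Cy]].
    by exists (B i).
  have Cr : (index C r < size r)%N by rewrite index_mem rP inE.
  exists (Ordinal Cr) => //.
  by rewrite /B/= nth_index// rP inE.
rewrite (big_nth set0) big_mkord -UB; apply: mu_add.
- by move=> i; exact: PS.
- move=> i j _ _ /(tP _ _ (PB i) (PB j))/eqP.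
  by rewrite nth_uniq// => /eqP/val_inj.
- by rewrite UB.
Qed.

Lemma partition_sup_le_charge (R : realType) (Omega : Type)
    (S : set (set Omega)) (s lambda : set Omega -> \bar R) :
  signed_charges S lambda -> le_on S s lambda ->
  le_on S (partition_sup S s) lambda.
Proof.
move=> clambda sl A SA; apply: ge_ereal_sup => _ [P PA <-].
rewrite (signed_charge_fsum clambda SA PA).
by case: PA => Pfin PS _; apply: lee_fsum => // C /PS /sl.
Qed.

(** Each [nu j] is additive, and its values on the pieces are at most those of
    the supremum; as addition on [\bar R] is monotone, this remains true when
    different charges avoid different infinite values. *)
Lemma pointwise_sup_sub_additive (R : realType) (Omega J : Type)
    (S : set (set Omega)) (nu : J -> set Omega -> \bar R) :
  range nu `<=` signed_charges S -> sub_additive S (pointwise_sup nu).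
Proof.
move=> cnu n A SA tA SUA; apply: ge_ereal_sup => _ [j _ <-].
have [_ _ nu_add] : signed_charges S (nu j) by apply: cnu; exists j.
rewrite nu_add//; apply: lee_sum => i _.
by apply: ereal_sup_ubound; exists j.
Qed.

Theorem theorem2p4 (R : realType) (Omega J : Type) (S : set (set Omega))
    (nu : J -> set Omega -> \bar R)
    (S_semi_ring : is_semi_ring S)
    (nu0 : forall j, set_function (nu j))
    (sup_nu : forall A, S A -> -oo < pointwise_sup nu A) :
  super_additive S (mu_sup S nu) /\
  (range nu `<=` signed_charges S ->
   signed_charges S (mu_sup S nu) /\
   is_sup_charges S (range nu) (mu_sup S nu)).
Proof.
have [S0 SI _] := S_semi_ring.
(* The supremum of an empty family would be -oo. *)
have [j0] : exists j : J, True.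
  have /ereal_sup_gt[_ [j _ _] _] := sup_nu _ S0; by exists j.
move=> _.
have s0 : set_function (pointwise_sup nu).
  rewrite /set_function /pointwise_sup -[RHS]ereal_sup1; congr ereal_sup.
  apply/seteqP; split=> [_ [j _ <-]|_ ->]; first exact: nu0.
  by exists j0 => //; exact: nu0.
have sup_mu : super_additive S (mu_sup S nu).
  exact: partition_sup_super_additive.
split=> // cnu.
have [mu0 muNy mu_super] := sup_mu.
have cmu : signed_charges S (mu_sup S nu).
  split=> //; first by right.
  move=> n A SA tA SUA; apply/eqP; rewrite eq_le mu_super// andbT.
  apply: partition_sup_sub_additive => //.
  exact: pointwise_sup_sub_additive.
split=> //; split=> // [_ [j _ <-] A SA|lambda clambda nul].
  apply: (@le_trans _ _ (pointwise_sup nu A)).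
    by apply: ereal_sup_ubound; exists j.
  exact: le_partition_sup.
apply: partition_sup_le_charge => // A SA.
by apply: ge_ereal_sup => _ [j _ <-]; apply: nul => //; exists j.
Qed.
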